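(* $$\int_0^{1} e^{-\arccos^2(x)}\,dx = -\frac{\sqrt{\pi}\, e^{-1/4}}{4}\left[\mathrm{erfi}\!\left(\frac{1}{2}-\frac{i\pi}{2}\right)+\mathrm{erfi}\!\left(\frac{1}{2}+\frac{i\pi}{2}\right)-2\,\mathrm{erfi}\!\left(\frac{1}{2}\right)\right].$$
   Context: For complex $z$, the imaginary error function is the entire function $\mathrm{erfi}(z)=\frac{2}{\sqrt{\pi}}\int_0^z e^{t^2}\,dt$ (integral along the straight segment from $0$ to $z$). Here $i$ is the imaginary unit. *)

(* Defs.v *)
From Stdlib Require Import Reals.
From Coquelicot Require Import Coquelicot.

Local Open Scope C_scope.

(* e^(a + bi) = e^a (cos b + i sin b) *)
Definition Cexp (z : C) : C :=
  RtoC (exp (Re z)) * (RtoC (cos (Im z)) + Ci * RtoC (sin (Im z))).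

(* The segment from 0 to z is parametrized by t = s z, 0 <= s <= 1, so that
   dt = z ds; the integral over s is that of a function from R to C. *)
Definition erfi (z : C) : C :=
  RtoC (2 / sqrt PI)%R *
  RInt (V := C_R_CompleteNormedModule)
    (fun s : R => Cexp ((RtoC s * z) ^ 2) * z) 0%R 1%R.

(* Main.v *)
(** Write [z = a + i y] and [f w = e^(w^2)]. Since
    [d/dy (f(s z) z) = d/ds (i s f(s z))], the segment integral of [f] from [0]
    to [z] has [y]-derivative [i f(z)]. For
    [a = 1/2] the real part of [i f(z)] is [- e^(1/4) e^(-y^2) sin y], which up
    to the factor [e^(1/4)] is the integrand obtained from the left-hand side by
    [x = cos y]. *)
Require Import Defs.
From Stdlib Require Import Reals Lra.
From Coquelicot Require Import Coquelicot.

Local Open Scope R_scope.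

(** With [z = a + i y], this is the real part of [z e^((s z)^2)] and [erfi_im] is its imaginary
    part, so that real calculus applies to each. *)
Definition erfi_re (a y s : R) : R :=
  exp (s ^ 2 * (a ^ 2 - y ^ 2))
  * (a * cos (2 * a * s ^ 2 * y) - y * sin (2 * a * s ^ 2 * y)).

Definition erfi_im (a y s : R) : R :=
  exp (s ^ 2 * (a ^ 2 - y ^ 2))
  * (y * cos (2 * a * s ^ 2 * y) + a * sin (2 * a * s ^ 2 * y)).

Lemma erfi_re_opp (a y s : R) : erfi_re a (- y) s = erfi_re a y s.
Proof.
unfold erfi_re.
replace (2 * a * s ^ 2 * - y) with (- (2 * a * s ^ 2 * y)) by ring.
replace ((- y) ^ 2) with (y ^ 2) by ring.
rewrite cos_neg, sin_neg; ring.
Qed.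

Lemma erfi_im_opp (a y s : R) : erfi_im a (- y) s = - erfi_im a y s.
Proof.
unfold erfi_im.
replace (2 * a * s ^ 2 * - y) with (- (2 * a * s ^ 2 * y)) by ring.
replace ((- y) ^ 2) with (y ^ 2) by ring.
rewrite cos_neg, sin_neg; ring.
Qed.

Lemma erfi_integrand_components (a y s : R) :
  (Cexp ((RtoC s * (a, y)) ^ 2) * (a, y))%C = (erfi_re a y s, erfi_im a y s).
Proof.
replace ((RtoC s * (a, y)) ^ 2)%C
  with ((s ^ 2 * (a ^ 2 - y ^ 2), 2 * a * s ^ 2 * y) : C)
  by (simpl; unfold Cmult, RtoC; simpl; f_equal; ring).
unfold erfi_re, erfi_im, Cexp, Cmult, Cplus, RtoC, Ci, Re, Im; cbn [fst snd].
f_equal; ring.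
Qed.

Lemma ex_RInt_erfi_re (a y : R) : ex_RInt (erfi_re a y) 0 1.
Proof.
apply (ex_RInt_continuous (V := R_CompleteNormedModule)); intros s _.
apply (ex_derive_continuous (V := R_NormedModule)).
now unfold erfi_re; auto_derive.
Qed.

Lemma ex_RInt_erfi_im (a y : R) : ex_RInt (erfi_im a y) 0 1.
Proof.
apply (ex_RInt_continuous (V := R_CompleteNormedModule)); intros s _.
apply (ex_derive_continuous (V := R_NormedModule)).
now unfold erfi_im; auto_derive.
Qed.

Lemma erfi_components (a y : R) :
  erfi (a, y) = (2 / sqrt PI * RInt (erfi_re a y) 0 1,
                 2 / sqrt PI * RInt (erfi_im a y) 0 1).
Proof.
assert (H : is_RInt (V := C_R_NormedModule)
              (fun s : R => (Cexp ((RtoC s * (a, y)) ^ 2) * (a, y))%C) 0 1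
              (RInt (erfi_re a y) 0 1, RInt (erfi_im a y) 0 1)).
{ apply (is_RInt_ext (V := C_R_NormedModule)
           (fun s => (erfi_re a y s, erfi_im a y s)));
    [intros s _; symmetry; apply erfi_integrand_components|].
  apply (is_RInt_fct_extend_pair (U := R_NormedModule) (V := R_NormedModule)).
  - apply (RInt_correct (V := R_CompleteNormedModule)), ex_RInt_erfi_re.
  - apply (RInt_correct (V := R_CompleteNormedModule)), ex_RInt_erfi_im. }
unfold erfi; rewrite (is_RInt_unique (V := C_R_CompleteNormedModule) _ _ _ _ H).
unfold Cmult, RtoC; cbn [fst snd]; f_equal; ring.
Qed.

(** The real part of the integrand is even in [y] and the imaginary part odd. Hence the values at
    the two conjugate points of the theorem add up to twice a real part. *)
Lemma erfi_Cconj (z : C) : erfi (Cconj z) = Cconj (erfi z).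
Proof.
destruct z as [a y].
unfold Cconj; cbn [fst snd]; rewrite !erfi_components; cbn [fst snd].
f_equal.
- f_equal; apply RInt_ext; intros s _; apply erfi_re_opp.
- rewrite Ropp_mult_distr_r; f_equal.
  rewrite <- (RInt_opp (V := R_CompleteNormedModule)) by apply ex_RInt_erfi_im.
  apply RInt_ext; intros s _; apply erfi_im_opp.
Qed.

Lemma erfi_real (a : R) : erfi (RtoC a) = RtoC (fst (erfi (RtoC a))).
Proof.
assert (H := erfi_Cconj (RtoC a)).
replace (Cconj (RtoC a)) with (RtoC a) in H
  by (unfold Cconj, RtoC; cbn [fst snd]; f_equal; ring).
destruct (erfi (RtoC a)) as [u v]; unfold Cconj in H; cbn [fst snd] in *.
injection H; intros Hv; unfold RtoC; f_equal; lra.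
Qed.

(** The real part of [i (1 + 2 s^2 z^2) e^((s z)^2)], the [y]-derivative of [z e^((s z)^2)]. *)
Definition erfi_re_dy (a y s : R) : R :=
  exp (s ^ 2 * (a ^ 2 - y ^ 2))
  * ((2 * s ^ 2 * y ^ 2 - 2 * a ^ 2 * s ^ 2 - 1) * sin (2 * a * s ^ 2 * y)
     - 4 * a * s ^ 2 * y * cos (2 * a * s ^ 2 * y)).

Lemma is_derive_erfi_re (a y s : R) :
  is_derive (fun u : R => erfi_re a u s) y (erfi_re_dy a y s).
Proof.
unfold erfi_re, erfi_re_dy; auto_derive; [exact I|].
unfold Rminus; simpl; ring.
Qed.

Lemma continuity_2d_pt_erfi_re_dy (a y s : R) :
  continuity_2d_pt (fun u v : R => erfi_re_dy a u v) y s.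
Proof.
unfold erfi_re_dy; simpl.
repeat first
  [ apply continuity_2d_pt_const | apply continuity_2d_pt_id1
  | apply continuity_2d_pt_id2 | apply continuity_2d_pt_mult
  | apply continuity_2d_pt_minus | apply continuity_2d_pt_plus
  | apply (continuity_1d_2d_pt_comp exp);
    [apply derivable_continuous_pt, derivable_pt_exp|]
  | apply (continuity_1d_2d_pt_comp sin); [apply continuity_sin|]
  | apply (continuity_1d_2d_pt_comp cos); [apply continuity_cos|] ].
Qed.

(* [erfi_re_dy a y] is also the [s]-derivative of the real part of
   [i s e^((s z)^2)]. *)
Lemma RInt_erfi_re_dy (a y : R) :
  RInt (erfi_re_dy a y) 0 1 = - (exp (a ^ 2 - y ^ 2) * sin (2 * a * y)).
Proof.
set (h := fun s : R =>
  - (s * exp (s ^ 2 * (a ^ 2 - y ^ 2)) * sin (2 * a * s ^ 2 * y))).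
replace (- _) with (minus (h 1) (h 0)).
2: { unfold h, minus, plus, opp; simpl.
     replace (1 * (1 * 1) * (a * (a * 1) - y * (y * 1)))
       with (a * (a * 1) - y * (y * 1)) by ring.
     replace (2 * a * (1 * (1 * 1)) * y) with (2 * a * y) by ring; ring. }
apply is_RInt_unique, (is_RInt_derive (V := R_CompleteNormedModule)); intros s _.
- unfold h, erfi_re_dy; auto_derive; [exact I|]; unfold Rminus; simpl; ring.
- apply (ex_derive_continuous (V := R_NormedModule)).
  now unfold erfi_re_dy; auto_derive.
Qed.

Lemma is_derive_RInt_erfi_re (a y : R) :
  is_derive (fun u : R => RInt (erfi_re a u) 0 1) y
    (- (exp (a ^ 2 - y ^ 2) * sin (2 * a * y))).
Proof.
(* The closed form is turned back into the integral of the [y]-derivative, as differentiation under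
   the integral sign yields it. *)
rewrite <- RInt_erfi_re_dy.
rewrite <- (RInt_ext (V := R_CompleteNormedModule)
              (fun s => Derive (fun u => erfi_re a u s) y))
  by (intros s _; apply is_derive_unique, is_derive_erfi_re).
apply (is_derive_RInt_param (erfi_re a)).
- apply filter_forall; intros u s _.
  eexists; apply is_derive_erfi_re.
- intros s _.
  apply continuity_2d_pt_ext with (fun u v => erfi_re_dy a u v).
  + intros u v; symmetry; apply is_derive_unique, is_derive_erfi_re.
  + apply continuity_2d_pt_erfi_re_dy.
- apply filter_forall; intros u; apply ex_RInt_erfi_re.
Qed.

(* At [x = 1], where [acos] is not differentiable, the formula
   [acos x = atan (sqrt (1 - x^2) / x)] still holds on both sides, because
   [acos] is [0] beyond [1] and [sqrt] is [0] on negative numbers. *)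
Lemma continuous_acos (x : R) : 0 <= x -> continuous acos x.
Proof.
intros [Hx | <-].
- apply continuous_ext_loc with (fun u => atan (sqrt (1 - u ^ 2) * / u)).
  + apply (locally_interval _ x 0 p_infty); simpl; auto.
    intros u Hu _; rewrite acos_atan by exact Hu.
    unfold Rdiv, Rsqr; do 4 f_equal; ring.
  + apply continuous_atan_comp.
    apply (continuous_mult (K := R_AbsRing) (fun u => sqrt (1 - u ^ 2)) Rinv).
    * apply (continuous_comp (fun u => 1 - u ^ 2) sqrt).
      -- apply (ex_derive_continuous (V := R_NormedModule)); now auto_derive.
      -- apply continuous_sqrt.
    * apply continuous_Rinv; lra.
(* At [0] the quotient formula fails, but [acos] is differentiable there. *)
- apply continuity_pt_filterlim, derivable_continuous_pt, derivable_pt_acos; lra.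
Qed.

Lemma RInt_exp_acos :
  RInt (fun x : R => exp (- (acos x ^ 2))) 0 1
  = exp (- (1 / 4)) * (RInt (erfi_re (1 / 2) 0) 0 1
                       - RInt (erfi_re (1 / 2) (PI / 2)) 0 1).
Proof.
assert (HPI := PI_RGT_0).
assert (Hmin : Rmin (PI / 2) 0 = 0) by (apply Rmin_right; lra).
assert (Hmax : Rmax (PI / 2) 0 = PI / 2) by (apply Rmax_left; lra).
(* The bounds of the left-hand integral become values of [cos]; the substitution then runs from
   [PI / 2] down to [0], which absorbs the minus sign of [- sin t]. *)
rewrite <- cos_PI2, <- cos_0 at 1.
rewrite <- (RInt_comp (V := R_CompleteNormedModule)
              (fun x => exp (- (acos x ^ 2))) cos (fun t => - sin t)).
- apply is_RInt_unique.
  apply (is_RInt_ext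
           (fun t => scal (exp (- (1 / 4)))
             (- (exp ((1 / 2) ^ 2 - t ^ 2) * sin (2 * (1 / 2) * t))))).
  + rewrite Hmin, Hmax; intros t Ht; rewrite acos_cos by lra.
    replace (2 * (1 / 2) * t) with t by field.
    replace (- t ^ 2) with (- (1 / 4) + ((1 / 2) ^ 2 - t ^ 2)) by field.
    rewrite exp_plus; unfold scal; simpl; unfold mult; simpl; ring.
  + apply (is_RInt_scal (V := R_NormedModule)).
    apply (is_RInt_derive (V := R_CompleteNormedModule)
             (fun t => RInt (erfi_re (1 / 2) t) 0 1)); intros t _.
    * apply is_derive_RInt_erfi_re.
    * apply (ex_derive_continuous (V := R_NormedModule)); now auto_derive.
(* The endpoint [t = 0] is included, so two-sided continuity of [acos] at [1] is required. *)
- rewrite Hmin, Hmax; intros t Ht.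
  apply (continuous_comp acos (fun u => exp (- (u ^ 2)))).
  + apply continuous_acos, cos_ge_0; lra.
  + apply (ex_derive_continuous (V := R_NormedModule)); now auto_derive.
- intros t _; split; [auto_derive; [exact I | ring]|].
  apply (ex_derive_continuous (V := R_NormedModule)); now auto_derive.
Qed.

Theorem theorem3p10 :
  (RtoC (RInt (fun x : R => exp (- (acos x ^ 2))) 0 1)%R
   = - RtoC (sqrt PI * exp (- (1 / 4)) / 4)%R
     * (erfi (RtoC (1 / 2)%R - Ci * RtoC (PI / 2)%R)
        + erfi (RtoC (1 / 2)%R + Ci * RtoC (PI / 2)%R)
        - RtoC 2%R * erfi (RtoC (1 / 2)%R)))%C.
Proof.
assert (Hz : (RtoC (1 / 2) + Ci * RtoC (PI / 2))%C = (1 / 2, PI / 2)).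
{ unfold RtoC, Ci, Cplus, Cmult; cbn [fst snd]; f_equal; lra. }
assert (Hzc : (RtoC (1 / 2) - Ci * RtoC (PI / 2))%C = Cconj (1 / 2, PI / 2)).
{ unfold RtoC, Ci, Cminus, Cplus, Copp, Cmult, Cconj; cbn [fst snd]; f_equal; lra. }
rewrite Hz, Hzc, erfi_Cconj, (erfi_real (1 / 2)), RInt_exp_acos.
(* The real point is the case [y = 0], which produces [erfi_re (1 / 2) 0]. *)
change (RtoC (1 / 2)) with ((1 / 2, 0) : C).
rewrite !erfi_components.
assert (HPI := sqrt_lt_R0 _ PI_RGT_0).
unfold RtoC, Cminus, Cplus, Copp, Cmult, Cconj; cbn [fst snd].
(* In the real part, [sqrt PI / 4] cancels the factor [2 / sqrt PI] of [erfi] times the [2] from the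
   conjugate pair; the imaginary parts cancel. *)
f_equal; field; lra.
Qed.
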